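(* Let weight $i$ have margined cell $[\ell_i,u_i]$ with writable width $\Delta_i=u_i-\ell_i>0$ and capped width $W_i$, so that $\Delta_i=(1-2\mu)W_i$. Let $w_i=\ell_i+x_i\Delta_i$ with in-cell position $x_i\in[0,1)$. For integers $k\ge1$ define the refinement code $r_i^{(k)}=\lfloor 2^kx_i\rfloor$ and the sub-cell-center reconstruction $\hat w_i^{(k)}=\ell_i+\big(r_i^{(k)}+\tfrac12\big)\Delta_i/2^k$. Then: (i) for all integers $k\ge1$ and $j\ge0$, $r_i^{(k)}=r_i^{(k+j)}\gg j$, where $n\gg j=\lfloor n/2^j\rfloor$; (ii) $|w_i-\hat w_i^{(k)}|\le W_i/2^{k+1}$; (iii) $\ell_i<\hat w_i^{(k)}<u_i$. Hence at every truncation depth $k$, re-quantizing $\hat w_i^{(k)}$ under the frozen scales returns the stored code $a_i$.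
   Context: Level table: reals $L[0]<\dots<L[15]$, midpoints $M[j]=(L[j]+L[j+1])/2$ for $j=0,\dots,14$. Weight $i$ has a frozen code $a_i\in\{0,\dots,15\}$ and a frozen block scale $s_{g(i)}>0$. Re-quantization under frozen scales assigns to a real value $x$ the code $\#\{j: M[j]<x/s_{g(i)}\}$. Capped cell: in normalized units, $\mathrm{lo}[j]=M[j-1]$ for $j\ge1$, $\mathrm{hi}[j]=M[j]$ for $j\le14$, $\mathrm{lo}[0]=L[0]-(M[0]-L[0])$, $\mathrm{hi}[15]=L[15]+(L[15]-M[14])$. Put $\mathrm{lo}_i=s_{g(i)}\mathrm{lo}[a_i]$, $\mathrm{hi}_i=s_{g(i)}\mathrm{hi}[a_i]$, $W_i=\mathrm{hi}_i-\mathrm{lo}_i$. With margin $\mu\in(0,1/2)$ (in practice $\mu=0.01$), $\ell_i=\mathrm{lo}_i+\mu W_i$ and $u_i=\mathrm{hi}_i-\mu W_i$. *)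

(* Defs.v *)
From HB Require Import structures.
From mathcomp Require Import all_boot all_order all_algebra.
From mathcomp Require Import reals.
Set Implicit Arguments.
Unset Strict Implicit.
Unset Printing Implicit Defensive.
Import Order.TTheory GRing.Theory Num.Theory.
Local Open Scope ring_scope.

Definition midpoint (R : realType) (L : 'I_16 -> R) (j : 'I_15) : R :=
  (L (inord j) + L (inord j.+1)) / 2.

Definition requantize (R : realType) (L : 'I_16 -> R) (sc x : R) : nat :=
  #|[set j : 'I_15 | midpoint L j < x / sc]|.

(* Cell ends in normalized units. The two outer cells, unbounded for
   [requantize], are capped by reflecting the inner end through the level. *)
Definition lo (R : realType) (L : 'I_16 -> R) (c : 'I_16) : R :=
  if c == ord0 then L ord0 - (midpoint L ord0 - L ord0)
  else midpoint L (inord c.-1).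

Definition hi (R : realType) (L : 'I_16 -> R) (c : 'I_16) : R :=
  if c == ord_max then L ord_max + (L ord_max - midpoint L ord_max)
  else midpoint L (inord c).

Definition cell_lo (R : realType) (L : 'I_16 -> R) (sc : R) (c : 'I_16) : R :=
  sc * lo L c.

Definition cell_hi (R : realType) (L : 'I_16 -> R) (sc : R) (c : 'I_16) : R :=
  sc * hi L c.

Definition capped_width (R : realType) (L : 'I_16 -> R) (sc : R) (c : 'I_16) : R :=
  cell_hi L sc c - cell_lo L sc c.

Definition margin_lo (R : realType) (L : 'I_16 -> R) (mu sc : R) (c : 'I_16) : R :=
  cell_lo L sc c + mu * capped_width L sc c.

Definition margin_hi (R : realType) (L : 'I_16 -> R) (mu sc : R) (c : 'I_16) : R :=
  cell_hi L sc c - mu * capped_width L sc c.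

Definition refinement_code (R : realType) (x : R) (k : nat) : int :=
  Num.floor (2 ^+ k * x).

Definition reconstruct (R : realType) (ell Delta : R) (k : nat) (r : int) : R :=
  ell + (r%:~R + 1 / 2) * Delta / 2 ^+ k.

Definition shiftr (n : int) (j : nat) : int :=
  Num.floor (n%:~R / 2 ^+ j : rat).

(* Main.v *)
Require Import Defs.
From HB Require Import structures.
From mathcomp Require Import all_boot all_order all_algebra.
From mathcomp Require Import reals.
From mathcomp Require Import zify ring lra.
Set Implicit Arguments.
Unset Strict Implicit.
Unset Printing Implicit Defensive.
Import Order.TTheory GRing.Theory Num.Theory.
Local Open Scope ring_scope.
(* The reconstruction is ell + t * Delta, where t = (r + 1/2) / 2^k is the
   center of the dyadic interval of length 2^-k containing x. So t lies in
   ]0, 1[ within 2^-(k+1) of x, which puts the reconstruction strictly inside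
   the cell of a_i: exactly the midpoints of index < a_i are below it. *)

Section LevelTable.

Variables (R : realType) (L : 'I_16 -> R).
Hypothesis HL : forall c d : 'I_16, (c < d)%N -> L c < L d.

Lemma midpoint_lt (i j : 'I_15) : (i < j)%N -> midpoint L i < midpoint L j.
Proof.
have := ltn_ord i; have := ltn_ord j => jlt ilt ij.
have lt1 : L (inord i) < L (inord j) by apply: HL; rewrite !inordK; lia.
have lt2 : L (inord i.+1) < L (inord j.+1) by apply: HL; rewrite !inordK; lia.
by rewrite /midpoint; lra.
Qed.

Lemma midpoint_le (i j : 'I_15) : (i <= j)%N -> midpoint L i <= midpoint L j.
Proof.
rewrite leq_eqVlt => /orP[/eqP/val_inj -> // | /midpoint_lt]; exact: ltW.
Qed.

Lemma level_lt_midpoint0 : L ord0 < midpoint L ord0.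
Proof.
have lt01 : L (inord 0) < L (inord 1) by apply: HL; rewrite !inordK.
have -> : ord0 = inord 0 :> 'I_16 by apply: val_inj; rewrite /= inordK.
by rewrite /midpoint /=; lra.
Qed.

Lemma midpoint_max_lt_level : midpoint L ord_max < L ord_max.
Proof.
have lt01 : L (inord 14) < L (inord 15) by apply: HL; rewrite !inordK.
have -> : ord_max = inord 15 :> 'I_16 by apply: val_inj; rewrite /= inordK.
by rewrite /midpoint /=; lra.
Qed.

(** For [c > 0] the end [lo L c] is itself the midpoint of index [c - 1], the largest index below
    [c]. For [c = 0] no index [j] qualifies, so the cap never enters. *)
Lemma midpoint_le_lo (c : 'I_16) (j : 'I_15) : (j < c)%N -> midpoint L j <= lo L c.
Proof.
have := ltn_ord c; rewrite /lo; case: eqP => [-> //|_] c16 jc.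
by apply: midpoint_le; rewrite inordK; lia.
Qed.

Lemma hi_le_midpoint (c : 'I_16) (j : 'I_15) : (c <= j)%N -> hi L c <= midpoint L j.
Proof.
have := ltn_ord j; rewrite /hi; case: eqP => [-> /=|_] j15 cj; first lia.
by apply: midpoint_le; rewrite inordK; lia.
Qed.

(** An inner cell lies between consecutive midpoints. An outer cell, capped by reflection, has width
    twice the distance from its level to the adjacent midpoint. *)
Lemma lo_lt_hi (c : 'I_16) : lo L c < hi L c.
Proof.
have c16 := ltn_ord c.
have [->|c_neq0] := eqVneq c ord0.
  rewrite /lo /hi eqxx (_ : (ord0 == ord_max :> 'I_16) = false) //.
  have -> : inord (ord0 : 'I_16) = ord0 :> 'I_15.
    by apply: val_inj; rewrite /= inordK.
  by have := level_lt_midpoint0; lra.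
have c_gt0 : (0 < c)%N by rewrite lt0n.
have [cmax|c_neqmax] := eqVneq c ord_max.
  rewrite cmax /hi /lo eqxx (_ : (ord_max == ord0 :> 'I_16) = false) //.
  have -> : inord (ord_max : 'I_16).-1 = ord_max :> 'I_15.
    by apply: val_inj; rewrite /= inordK.
  by have := midpoint_max_lt_level; lra.
rewrite /lo /hi (negPf c_neq0) (negPf c_neqmax).
have c_neq15 : c != 15%N :> nat by rewrite -(inj_eq val_inj) in c_neqmax.
by apply: midpoint_lt; rewrite !inordK; lia.
Qed.

Lemma requantize_cell (sc y : R) (c : 'I_16) : 0 < sc ->
  cell_lo L sc c < y < cell_hi L sc c -> requantize L sc y = c.
Proof.
move=> sc_gt0; rewrite /cell_lo /cell_hi ![sc * _]mulrC.
rewrite -(ltr_pdivlMr _ y sc_gt0) -(ltr_pdivrMr _ y sc_gt0) => /andP[lo_lt lt_hi].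
have c15 : (c <= 15)%N by rewrite -ltnS.
have midE (j : 'I_15) : (midpoint L j < y / sc) = (j < c)%N.
  have [jc|cj] := ltnP j c; first exact: le_lt_trans (midpoint_le_lo jc) lo_lt.
  by rewrite ltNge (ltW (lt_le_trans lt_hi (hi_le_midpoint cj))).
rewrite /requantize cardsE -sum1_card (eq_bigl _ _ midE).
(* Since [c <= 15], the indices of ['I_15] below [c] are counted by ['I_c]. *)
by rewrite (big_ord_narrow c15) sum1_card card_ord.
Qed.

End LevelTable.

Section RefinementCode.

Variables (R : realType) (x : R).
Implicit Types k j : nat.

Lemma exp2_gt0 (F : numFieldType) k : 0 < 2 ^+ k :> F.
Proof. by rewrite exprn_gt0. Qed.

Lemma refinement_code_itv k :
  (refinement_code x k)%:~R <= 2 ^+ k * x < (refinement_code x k)%:~R + 1.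
Proof. by have := floor_itv (2 ^+ k * x); rewrite intrD. Qed.

(** Nested floors: [m <= n / 2 ^+ j < m + 1] follows by comparing both codes with the common real
    [2 ^+ (k + j) * x]. *)
Lemma shiftr_refinement_code k j :
  shiftr (refinement_code x (k + j)) j = refinement_code x k.
Proof.
set n := refinement_code x (k + j); set m := refinement_code x k.
have /andP[nle nlt] : n%:~R <= 2 ^+ k * x * 2 ^+ j < n%:~R + 1.
  by have := refinement_code_itv (k + j); rewrite exprD mulrAC.
have /andP[mle mlt] := refinement_code_itv k.
(* [shiftr] floors a rational, the codes floor reals; the integers mediate between the two
   fields. *)
have cast2 (F : numFieldType) : 2 ^+ j = (2 ^+ j : int)%:~R :> F by rewrite rmorphXn.
apply: floor_def; rewrite ler_pdivlMr ?ltr_pdivrMr ?exp2_gt0 //.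
rewrite cast2 -!intrM ler_int ltr_int; apply/andP; split.
  (* By integrality [m * 2 ^+ j <= n] amounts to [m * 2 ^+ j < n + 1], which the real bounds do
     give. *)
  rewrite -ltzD1 -(ltr_int R) intrM -cast2 intrD.
  by apply: le_lt_trans nlt; rewrite ler_pM2r ?exp2_gt0.
rewrite -(ltr_int R) intrM -cast2 intrD.
by apply: le_lt_trans nle _; rewrite ltr_pM2r ?exp2_gt0.
Qed.

(** Scaled by [2 ^+ k], the error is the fractional part of [2 ^+ k * x] minus 1/2. *)
Lemma subcell_center_error k :
  `|x - ((refinement_code x k)%:~R + 1 / 2) / 2 ^+ k| <= (2 ^+ k.+1)^-1.
Proof.
have /andP[rle rlt] := refinement_code_itv k.
set r := (refinement_code x k)%:~R in rle rlt *; have e_gt0 := exp2_gt0 R k.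
have -> : x - (r + 1 / 2) / 2 ^+ k = (2 ^+ k * x - (r + 1 / 2)) / 2 ^+ k.
  by field; rewrite gt_eqF.
rewrite normrM normfV (gtr0_norm e_gt0) exprS invfM ler_pM2r ?invr_gt0 //.
by rewrite ler_norml; lra.
Qed.

Lemma subcell_center_itv k : 0 <= x < 1 ->
  0 < ((refinement_code x k)%:~R + 1 / 2 : R) / 2 ^+ k < 1.
Proof.
move=> /andP[x_ge0 x_lt1]; have e_gt0 := exp2_gt0 R k.
have /andP[rle rlt] := refinement_code_itv k.
have r_ge0 : 0 <= refinement_code x k.
  by rewrite /refinement_code floor_ge0 mulr_ge0 // ltW.
(* Integrality turns [r < 2 ^+ k] into a gap of 1, so adding 1/2 to [r] stays strictly below
   [2 ^+ k]. *)
have r_lt : refinement_code x k + 1 <= 2 ^+ k.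
  rewrite lezD1 -(ltr_int R) rmorphXn /=; apply: le_lt_trans rle _.
  by rewrite gtr_pMr.
have r_geR : 0 <= (refinement_code x k)%:~R :> R by rewrite ler0z.
have r_ltR : (refinement_code x k)%:~R + 1 <= 2 ^+ k :> R.
  by move: r_lt; rewrite -(ler_int R) intrD rmorphXn.
by rewrite divr_gt0 ?ltr_pdivrMr //=; lra.
Qed.

End RefinementCode.

Theorem proposition3 (R : realType) (L : 'I_16 -> R)
    (HL : forall c d : 'I_16, (c < d)%N -> L c < L d)
    (weight block : Type) (g : weight -> block)
    (s : block -> R) (Hs : forall b : block, 0 < s b)
    (a : weight -> 'I_16)
    (mu : R) (Hmu : 0 < mu < 1 / 2)
    (i : weight) (w x : R) :
  let W := capped_width L (s (g i)) (a i) in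
  let ell := margin_lo L mu (s (g i)) (a i) in
  let u := margin_hi L mu (s (g i)) (a i) in
  let Delta := u - ell in
  let r := refinement_code x in
  let what := fun k : nat => reconstruct ell Delta k (r k) in
  0 <= x < 1 ->
  w = ell + x * Delta ->
  [/\ 0 < Delta /\ Delta = (1 - 2 * mu) * W,
      forall k j : nat, (1 <= k)%N -> r k = shiftr (r (k + j)%N) j,
      forall k : nat, (1 <= k)%N -> `|w - what k| <= W / 2 ^+ k.+1 &
      forall k : nat, (1 <= k)%N ->
        ell < what k < u /\ requantize L (s (g i)) (what k) = a i].
Proof.
move=> W ell u Delta r what x01 ->.
have /andP[mu_gt0 mu_lt] := Hmu; have s_gt0 := Hs (g i).
have W_gt0 : 0 < W by rewrite subr_gt0 ltr_pM2l ?lo_lt_hi.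
have DeltaE : Delta = (1 - 2 * mu) * W.
  by rewrite /Delta /u /ell /margin_hi /margin_lo -/W /W /capped_width; ring.
have Delta_gt0 : 0 < Delta by rewrite DeltaE mulr_gt0 //; lra.
have whatE k : what k = ell + ((r k)%:~R + 1 / 2) / 2 ^+ k * Delta.
  by rewrite /what /reconstruct mulrAC.
split=> // [k j _|k _|k _]; first by rewrite shiftr_refinement_code.
  rewrite whatE opprD addrACA subrr add0r -mulrBl normrM (gtr0_norm Delta_gt0).
  rewrite mulrC ler_pM ?normr_ge0 ?(ltW Delta_gt0) ?subcell_center_error //.
  (* The error is at most [Delta / 2 ^+ k.+1], and [Delta <= W] because the margins only shrink the
     cell. *)
  by rewrite DeltaE ger_pMl //; lra.
have /andP[t_gt0 t_lt1] := subcell_center_itv k x01.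
have what_itv : ell < what k < u.
  rewrite whatE ltrDl mulr_gt0 //= -[u](subrKC ell) ltrD2l.
  by rewrite gtr_pMl.
split=> //; apply: requantize_cell => //.
(* The margin [mu * W] is positive, so [ell] and [u] lie inside the capped cell and the strict
   bounds carry over to its ends. *)
have /andP[lt_what what_lt] := what_itv; have muW_gt0 := mulr_gt0 mu_gt0 W_gt0.
rewrite (le_lt_trans _ lt_what) ?(lt_le_trans what_lt) //.
- by rewrite /u /margin_hi gerBl ltW.
- by rewrite /ell /margin_lo lerDl ltW.
Qed.
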